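(* Let $A$ be a finite alphabet and $m\ge0$ an integer. Given $\alpha\in(0,1)$ and a code $\varphi$ over $A$, let $T_\varphi^{SI}(A,\alpha)$ be the test which, from a sample $x_1\ldots x_t$ ($t>m$), accepts $H_0^{SI}$ if $$(t-m)\,h_m^*(x_1\ldots x_t)-|\varphi(x_1\ldots x_t)|\le\log(1/\alpha)$$ and rejects $H_0^{SI}$ otherwise. Then: i) For any code $\varphi$ and any $\alpha\in(0,1)$, the Type I error of $T_\varphi^{SI}(A,\alpha)$ is less than or equal to $\alpha$. ii) If, in addition, $\varphi$ is a universal code, then the Type II error of $T_\varphi^{SI}(A,\alpha)$ goes to $0$ as $t$ tends to infinity.
   Context: $\log=\log_2$, $0\log0=0$. A source over $A$ is a probability measure on $A^\infty$; it is stationary if invariant under the shift, and ergodic if every shift-invariant set has probability 0 or 1. $M_\infty(A)$ is the set of stationary ergodic sources. $M_m(A)\subset M_\infty(A)$ is the set of Markov sources of order at most $m$: the conditional distribution of $x_{t+1}$ given the whole past $x_t,x_{t-1},\dots$ depends only on $x_t,\dots,x_{t-m+1}$, for all $t\ge m$ ($M_0(A)$ is the set of i.i.d. sources). Hypotheses: $H_0^{SI}$: the source generating the sample belongs to $M_m(A)$. $H_1^{SI}$: the sample is generated by a stationary and ergodic source not satisfying $H_0^{SI}$, i.e. from $M_\infty(A)\setminus M_m(A)$. The Type I error is the probability of rejecting $H_0^{SI}$ when it is true (for every source in $M_m(A)$); the Type II error is the probability of accepting $H_0^{SI}$ when $H_1^{SI}$ is true (for each fixed source in $M_\infty(A)\setminus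 M_m(A)$), on samples of length $t$. Empirical entropy: for a word $x=x_1\ldots x_t$ and a word $v$ of length $k$, $\nu_x(v)$ is the number of (possibly overlapping) occurrences of $v$ among $x_1\ldots x_k,\ x_2\ldots x_{k+1},\dots,x_{t-k+1}\ldots x_t$; $\bar\nu_x(v)=\sum_{a\in A}\nu_x(va)$; for $0\le k<t$, $$h_k^*(x)=-\sum_{v\in A^k}\frac{\bar\nu_x(v)}{t-k}\sum_{a\in A}\frac{\nu_x(va)}{\bar\nu_x(v)}\log\frac{\nu_x(va)}{\bar\nu_x(v)},$$ where terms with $\bar\nu_x(v)=0$ are zero. A code $\varphi$ over $A$ is a family of maps $\varphi_n:A^n\to\{0,1\}^*$, $n=1,2,\dots$ (one writes $\varphi(u)=\varphi_n(u)$ for $u\in A^n$), such that for each $n$ the map $\varphi_n$ is injective and every concatenation $\varphi_n(u_1)\cdots\varphi_n(u_r)$, $r\ge1$, $u_i\in A^n$, can be uniquely decoded into $u_1\cdots u_r$. $|\varphi(u)|$ is the codeword length. Shannon entropy: $h_k(P)=-\sum_{v\in A^k}P(v)\sum_{a\in A}P(a|v)\log P(a|v)$, $h_\infty(P)=\lim_{k\to\infty}h_k(P)$. A code $\varphi$ is universal if for every stationary ergodic source $P$ over $A$: $\lim_{t\to\infty}|\varphi(x_1\cdots x_t)|/t=h_\infty(P)$ with $P$-probability 1 and $\lim_{t\to\infty}E(|\varphi(x_1\cdots x_t)|)/t=h_\infty(P)$. *)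

(* Defs.v *)
From HB Require Import structures.
From mathcomp Require Import all_boot all_order all_algebra.
From mathcomp Require Import all_classical all_reals all_analysis.

Set Implicit Arguments.
Unset Strict Implicit.
Unset Printing Implicit Defensive.

Import Order.TTheory GRing.Theory Num.Theory.
Import numFieldNormedType.Exports.

Local Open Scope classical_set_scope.
Local Open Scope ring_scope.

(* A nonempty finite alphabet. The distinguished letter is never used: it only
   provides the point that measurableType requires of nat -> A (over an empty
   alphabet there is no source at all). *)
#[short(type="alphabetType")]
HB.structure Definition Alphabet := {A of Finite A & Pointed A}.

(* The letter x_(i+1) of an infinite sequence x : nat -> A is x i. *)
Definition prefix_of (A : Type) (t : nat) (x : nat -> A) : t.-tuple A :=
  [tuple x i | i < t].

Definition shift (A : Type) (x : nat -> A) : nat -> A := fun i => x i.+1.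

Definition cylinder (A : Type) (v : seq A) : set (nat -> A) :=
  [set x | prefix_of (size v) x = v :> seq A].

Definition cylinders (A : Type) : set (set (nat -> A)) := range (@cylinder A).

(* A source: a probability on A^oo with its product sigma-algebra, i.e. the one
   generated by the cylinders. *)
Notation source R A :=
  (probability (g_sigma_algebraType (@cylinders A)) R).

(* Number of (possibly overlapping) occurrences of v in x. *)
Definition occurrences (A : eqType) (x v : seq A) : nat :=
  (\sum_(0 <= i < (size x).+1 - size v)
     (take (size v) (drop i x) == v))%N.

Definition ctx_occurrences (A : finType) (x v : seq A) : nat :=
  (\sum_(a : A) occurrences x (rcons v a))%N.

Section sources.
Context {R : realType} {A : alphabetType}.
Implicit Types (P : source R A) (u v : seq A) (a : A).

Definition stationary P : Prop :=
  forall B : set (g_sigma_algebraType (@cylinders A)),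
    measurable B -> P (@shift A @^-1` B) = P B.

Definition ergodic P : Prop :=
  forall B : set (g_sigma_algebraType (@cylinders A)),
    measurable B -> @shift A @^-1` B = B -> P B = 0%E \/ P B = 1%E.

Definition M_infty : set (source R A) :=
  [set P | stationary P /\ ergodic P].

(* P(v), the probability that a sequence starts with v. *)
Definition word_prob P v : R := fine (P (cylinder v)).

(* P(a|v); it is 0 when P(v) = 0 since division by 0 yields 0. *)
Definition cond_prob P v a : R := word_prob P (rcons v a) / word_prob P v.

(* Order at most m: the law of x_(t+1) given x_1 ... x_t = u is a function of
   the last m letters of u (only pasts of positive probability matter). *)
Definition markov_sources (m : nat) : set (source R A) :=
  [set P | M_infty P /\
    forall (t : nat) (u u' : t.-tuple A) a, (m <= t)%N ->
      0 < word_prob P u -> 0 < word_prob P u' ->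
      drop (t - m) u = drop (t - m) u' ->
      cond_prob P u a = cond_prob P u' a].

(* log2 0 = 0 because ln 0 = 0; in particular 0 * log2 0 = 0. *)
Definition log2 (r : R) : R := ln r / ln 2.

Definition entropy P (k : nat) : R :=
  - \sum_(v : k.-tuple A)
      word_prob P v * \sum_(a : A) cond_prob P v a * log2 (cond_prob P v a).

Definition entropy_rate P : R := limn (entropy P).

(* Meaningful for k < t; a context v that does not occur contributes 0 because
   of the factor (ctx_occurrences x v)%:R. *)
Definition empirical_entropy (k t : nat) (x : t.-tuple A) : R :=
  - \sum_(v : k.-tuple A)
      (ctx_occurrences x v)%:R / (t - k)%:R *
      \sum_(a : A)
        (let q := (occurrences x (rcons v a))%:R / (ctx_occurrences x v)%:R in
         q * log2 q).

End sources.

Definition block_map (A : Type) := forall n : nat, n.-tuple A -> seq bool.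

(* Codewords of blocks of the same length n >= 1 can be concatenated and
   uniquely decoded; the number of blocks is not known to the decoder. The
   value of phi on the empty word is irrelevant. *)
Definition is_code (A : finType) (phi : block_map A) : Prop :=
  forall n : nat, (0 < n)%N ->
    injective (phi n) /\
    forall us vs : seq (n.-tuple A), us != [::] -> vs != [::] ->
      flatten (map (phi n) us) = flatten (map (phi n) vs) -> us = vs.

Definition code_length (A : Type) (phi : block_map A) (t : nat)
  (x : nat -> A) : nat := size (phi t (prefix_of t x)).

Definition universal (R : realType) (A : alphabetType) (phi : block_map A) :
    Prop :=
  forall P : source R A, M_infty P ->
    {ae P, forall x : nat -> A,
      (fun t => (code_length phi t x)%:R / t%:R) @ \oo --> entropy_rate P} /\
    (fun t => 'E_P[fun x => (code_length phi t x)%:R] / (t%:R)%:E)%E @ \oo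
      --> (entropy_rate P)%:E.

(* The test applied to a sample of length t; meaningful for t > m. *)
Definition accepts (R : realType) (A : alphabetType) (m : nat) (alpha : R)
    (phi : block_map A) (t : nat) (x : t.-tuple A) : bool :=
  (t - m)%:R * empirical_entropy m x - (size (phi t x))%:R
    <= log2 (1 / alpha).

Definition accept_prob (R : realType) (A : alphabetType) (m : nat) (alpha : R)
    (phi : block_map A) (P : source R A) (t : nat) : \bar R :=
  P [set x | accepts m alpha phi (prefix_of t x)].

Definition reject_prob (R : realType) (A : alphabetType) (m : nat) (alpha : R)
    (phi : block_map A) (P : source R A) (t : nat) : \bar R :=
  P [set x | ~~ accepts m alpha phi (prefix_of t x)].

(* Main.v *)
(** i) For a source of order m, the probability of x_1...x_t is at most the
    product of its transition probabilities; by Gibbs' inequality these may be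
    replaced by the empirical ones, so P(x) <= 2^(-(t-m) h*_m(x)). Hence
    P(x) <= alpha 2^(-|phi(x)|) on the rejection region, and the
    Kraft-McMillan inequality bounds its probability by alpha.

    ii) By the ergodic theorem the word frequencies, hence h*_m, converge almost
    surely, to the word probabilities and to h_m(P) respectively, whereas
    |phi|/t tends to h_oo(P). If P is not of order m, some h_k(P) with k >= m is
    strictly below h_m(P) (equality case of Gibbs' inequality), so
    h_oo(P) < h_m(P) and almost surely the test eventually always rejects. *)

Require Import Defs.
From HB Require Import structures.
From mathcomp Require Import all_boot all_order all_algebra.
From mathcomp Require Import all_classical all_reals all_analysis.
From mathcomp Require Import measurable_realfun zify ring lra.

Import Order.TTheory GRing.Theory Num.Theory.
Import numFieldNormedType.Exports.

Local Open Scope classical_set_scope.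
Local Open Scope ring_scope.

(* [shift] of all_analysis is the translation of a normed space. *)
Local Notation shift := Defs.shift.

(** * Gibbs' inequality and x ln x *)

Section gibbs.
Context {R : realType}.
Implicit Types (x p q : R).

Lemma lt_ln_sub1 x : 0 < x -> x != 1 -> ln x < x - 1.
Proof.
move=> x0 x1; rewrite ltrBrDl -[ltRHS](lnK x0).
by apply: expR_gt1Dx; rewrite ln_eq0.
Qed.

(** This is [ln y < y - 1] at [y = q / p]. The implication [q = 0 -> p = 0] excludes the case where
    the convention [ln 0 = 0] would spoil the bound. *)
Lemma gibbs_term_lt p q : 0 <= p -> 0 <= q -> (q = 0 -> p = 0) -> p != q ->
  p * (ln q - ln p) < q - p.
Proof.
rewrite le0r => /predU1P[-> q0 _|p0].
  by rewrite mul0r subr0 lt0r eq_sym => ->.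
rewrite le0r => /predU1P[-> /(_ erefl) p_eq0|q0 _ pq].
  by rewrite p_eq0 ltxx in p0.
rewrite -ln_div ?posrE// (@lt_le_trans _ _ (p * (q / p - 1)))//.
  rewrite ltr_pM2l// lt_ln_sub1 ?divr_gt0//.
  by apply: contra pq => /eqP /divr1_eq ->.
by rewrite mulrBr mulr1 mulrCA divff ?mulr1 ?gt_eqF.
Qed.

Lemma gibbs_term p q : 0 <= p -> 0 <= q -> (q = 0 -> p = 0) ->
  p * (ln q - ln p) <= q - p.
Proof.
move=> p0 q0 qp; have [->|pq] := eqVneq p q; first by rewrite !subrr mulr0.
exact/ltW/gibbs_term_lt.
Qed.

(** The termwise bounds add up to the difference of the totals. An inequality between the totals
    admits conditional probabilities, whose sum is 0 in a null context. *)
Lemma gibbs (I : finType) (p q : I -> R) :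
  (forall i, 0 <= p i) -> (forall i, 0 <= q i) -> (forall i, q i = 0 -> p i = 0) ->
  \sum_i q i <= \sum_i p i ->
  \sum_i p i * ln (q i) <= \sum_i p i * ln (p i).
Proof.
move=> p0 q0 qp le_qp; rewrite -subr_le0 -sumrB.
apply: (@le_trans _ _ (\sum_i (q i - p i))); last by rewrite sumrB subr_le0.
by apply: ler_sum => i _; rewrite -mulrBr gibbs_term//; exact: qp.
Qed.

Lemma gibbs_lt (I : finType) (p q : I -> R) :
  (forall i, 0 <= p i) -> (forall i, 0 <= q i) -> (forall i, q i = 0 -> p i = 0) ->
  \sum_i q i <= \sum_i p i -> (exists i, p i != q i) ->
  \sum_i p i * ln (q i) < \sum_i p i * ln (p i).
Proof.
move=> p0 q0 qp le_qp [j pqj]; rewrite -subr_lt0 -sumrB.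
apply: (@lt_le_trans _ _ (\sum_i (q i - p i))); last by rewrite sumrB subr_le0.
rewrite (bigD1 j)//= [ltRHS](bigD1 j)//=.
apply: ltr_leD; first by rewrite -mulrBr gibbs_term_lt//; exact: qp.
by apply: ler_sum => i _; rewrite -mulrBr gibbs_term//; exact: qp.
Qed.

Lemma norm_xlnx_le1 x : 0 <= x <= 1 -> `|x * ln x| <= 1.
Proof.
move=> /andP[x0 x1]; have H : - (x * ln x) <= 1 - x.
  have := @gibbs_term x 1 x0 ler01; rewrite ln1 sub0r mulrN; apply.
  by move/eqP; rewrite oner_eq0.
rewrite ler0_norm; last by rewrite mulr_ge0_le0// ln_le0.
by rewrite (le_trans H)// gerBl.
Qed.

Lemma cvg_xlnx (u : R^nat) (l : R) : (forall n, 0 <= u n) -> u @ \oo --> l ->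
  u n * ln (u n) @[n --> \oo] --> l * ln l.
Proof.
move=> u0 ul.
have l0 : 0 <= l.
  rewrite -(cvg_lim (@Rhausdorff R) ul); apply: limr_ge; last exact: nearW.
  by apply/cvg_ex; exists l.
move: l0; rewrite le0r => /predU1P[l0|l0]; last first.
  apply: cvgM => //; apply: continuous_cvg => //; exact: continuous_ln.
rewrite {}l0 mul0r in ul *.
(* At the limit 0, where [ln] is not continuous, set [y = sqrt u]: then [u ln u = 2 y (y ln y)] is
   at most [2 y] in absolute value once [y <= 1]. *)
have su : Num.sqrt (u n) @[n --> \oo] --> (0 : R).
  by rewrite -[X in _ --> X](@sqrtr0 R); apply: continuous_cvg => //; exact: sqrt_continuous.
apply/norm_cvg0P.
apply: (@squeeze_cvgr _ _ _ _ (fun=> 0) (fun n => 2 * Num.sqrt (u n))).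
- have : \forall n \near \oo, u n < 1.
    by exact: (cvgr_lt _ ul _ ltr01).
  apply: filterS => n un1; rewrite normr_ge0/=.
  set y := Num.sqrt (u n).
  have y0 : 0 <= y by exact: sqrtr_ge0.
  have y1 : y <= 1 by rewrite -[leRHS](@sqrtr1 R) ler_wsqrtr// ltW.
  have uE : u n = y * y by rewrite -expr2 sqr_sqrtr.
  have [->|yn0] := eqVneq (u n) 0; first by rewrite mul0r normr0 mulr_ge0.
  have {yn0} yp : 0 < y by rewrite sqrtr_gt0 lt0r yn0 u0.
  have -> : u n * ln (u n) = 2 * (y * (y * ln y)).
    by rewrite uE lnM ?posrE//; ring.
  rewrite normrM (ger0_norm (ler0n _ _)) ler_pM2l// normrM ger0_norm//.
  by rewrite ler_piMr// norm_xlnx_le1// y0.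
- exact: cvg_cst.
- by rewrite -[X in _ --> X](mulr0 2); apply: cvgM => //; exact: cvg_cst.
Qed.
End gibbs.

(** * Word probabilities *)

Lemma prefix_ofE (A : Type) (t : nat) (x : nat -> A) :
  prefix_of t x = mkseq x t :> seq A.
Proof. by rewrite /prefix_of /mkseq -val_enum_ord -map_comp. Qed.

Lemma cylinderE (A : Type) (v : seq A) :
  cylinder v = [set x | mkseq x (size v) = v].
Proof. by apply/seteqP; split=> x /=; rewrite /cylinder/= prefix_ofE. Qed.

Lemma iter_shiftE (A : Type) (n i : nat) (x : nat -> A) :
  iter n (@shift A) x i = x (n + i)%N.
Proof. by elim: n i => // n IH i; rewrite iterS /Defs.shift IH addnS. Qed.

Lemma mkseqD (A : Type) (x : nat -> A) (m n : nat) :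
  mkseq x (m + n) = mkseq x m ++ mkseq (iter m (@shift A) x) n.
Proof.
rewrite /mkseq iotaD map_cat add0n -[m in iota m n]addn0 iotaDl -map_comp.
by congr (_ ++ _); apply: eq_map => i /=; rewrite iter_shiftE.
Qed.

Lemma mkseq_catP (A : Type) (x : nat -> A) (v w : seq A) :
  mkseq x (size v + size w) = v ++ w <->
  mkseq x (size v) = v /\ mkseq (iter (size v) (@shift A) x) (size w) = w.
Proof.
rewrite mkseqD; split=> [E|[-> ->]//].
have := congr1 (take (size v)) E; have := congr1 (drop (size v)) E.
by rewrite !drop_size_cat ?take_size_cat ?size_mkseq.
Qed.

(** Finite additivity; disjointness is stated pointwise so that several indices may carry the empty
    set. *)
Lemma measure_finType_partition (d : measure_display) (T : measurableType d)
    (R : realType) (mu : {measure set T -> \bar R}) (I : finType)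
    (F : I -> set T) (E : set T) :
  (forall i, measurable (F i)) -> (forall x, E x <-> exists i, F i x) ->
  (forall i j x, F i x -> F j x -> i = j) ->
  mu E = (\sum_i mu (F i))%E.
Proof.
move=> mF EF disjF.
have -> : E = \bigcup_(i in [set: I]) F i.
  by apply/seteqP; split=> x => [/EF[i Fi]|[i _ Fi]]; [exists i|apply/EF; exists i].
rewrite measure_fin_bigcup//.
- rewrite (fsbigE (index_enum I)) ?index_enum_uniq//; last first.
    by move=> i _; rewrite mem_index_enum.
  by apply: eq_bigl => i; rewrite in_setT.
- exact: finite_finset.
- by move=> i j _ _ [x [Fi Fj]]; exact: disjF Fi Fj.
Qed.

Section words.
Context {R : realType} {A : alphabetType}.
Implicit Types (P : source R A) (v w : seq A) (a : A).

Lemma measurable_cylinder v :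
  measurable (cylinder v : set (g_sigma_algebraType (@cylinders A))).
Proof. by apply: sub_sigma_algebra; exists v. Qed.

Lemma word_probE P v : P (cylinder v) = (word_prob P v)%:E.
Proof.
by rewrite /word_prob fineK// fin_num_measure//; exact: measurable_cylinder.
Qed.

Lemma word_prob_ge0 P v : 0 <= word_prob P v.
Proof. by rewrite fine_ge0. Qed.

Lemma cylinder_tupleP (t : nat) (u : t.-tuple A) (x : nat -> A) :
  cylinder u x <-> prefix_of t x = u.
Proof.
rewrite cylinderE/= size_tuple; split=> [E|<-]; last by rewrite prefix_ofE.
by apply: val_inj; rewrite /= -E -prefix_ofE.
Qed.

Lemma prefix_eventE (t : nat) (p : pred (t.-tuple A)) :
  [set x | p (prefix_of t x)] =
  \big[setU/set0]_(u : t.-tuple A | p u) cylinder u.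
Proof.
rewrite -bigcup_seq_cond; apply/seteqP; split=> [x /= px|x [u /= /andP[_ pu]]].
  exists (prefix_of t x); last exact/cylinder_tupleP.
  by apply/andP; rewrite mem_index_enum.
by move/cylinder_tupleP => ->.
Qed.

Lemma measurable_prefix_event (t : nat) (p : pred (t.-tuple A)) :
  measurable ([set x | p (prefix_of t x)] :
    set (g_sigma_algebraType (@cylinders A))).
Proof.
rewrite prefix_eventE; apply: bigsetU_measurable => u _.
exact: measurable_cylinder.
Qed.

Lemma prefix_event_prob P (t : nat) (p : pred (t.-tuple A)) :
  P [set x | p (prefix_of t x)] =
  (\sum_(u : t.-tuple A | p u) word_prob P u)%:E.
Proof.
rewrite (@measure_finType_partition _ _ R P _
  (fun u : t.-tuple A => if p u then cylinder u else set0)).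
- rewrite -sumEFin [RHS]big_mkcond/=; apply: eq_bigr => u _.
  by case: ifP => _; [exact: word_probE|exact: measure0].
- by move=> u; case: ifP => _ //; exact: measurable_cylinder.
- move=> x; split=> /= [px|[u]].
    by exists (prefix_of t x); rewrite px; apply/cylinder_tupleP.
  by case: ifP => // pu /cylinder_tupleP ->.
- move=> u u' x; case: ifP => // _ /cylinder_tupleP <-.
  by case: ifP => // _ /cylinder_tupleP.
Qed.

Lemma word_prob_nil P : word_prob P [::] = 1.
Proof.
rewrite /word_prob (_ : cylinder [::] = setT) ?probability_setT//.
by rewrite cylinderE; apply/seteqP; split.
Qed.

Lemma sum_word_prob_rcons P v :
  \sum_(a : A) word_prob P (rcons v a) = word_prob P v.
Proof.
apply: EFin_inj; rewrite -sumEFin -word_probE; apply/esym.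
under eq_bigr do rewrite -word_probE.
apply: measure_finType_partition.
- by move=> a; exact: measurable_cylinder.
- move=> x; rewrite cylinderE/=; split=> [E|[a]].
    exists (x (size v)); rewrite cylinderE/= -cats1 size_cat.
    apply/mkseq_catP; split=> //.
    by rewrite /mkseq/= iter_shiftE addn0.
  by rewrite cylinderE/= -cats1 size_cat => /mkseq_catP[].
- move=> a b x; rewrite !cylinderE/= !size_rcons => -> /eqP.
  by rewrite eqseq_rcons => /andP[_ /eqP].
Qed.

Lemma measurable_shift :
  measurable_fun [set: g_sigma_algebraType (@cylinders A)]
    (@shift A : g_sigma_algebraType (@cylinders A) ->
                g_sigma_algebraType (@cylinders A)).
Proof.
apply: (@measurability _ _ (g_sigma_algebraType (@cylinders A))
  (g_sigma_algebraType (@cylinders A)) setT (@shift A) (@cylinders A)) => //.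
move=> _ [_ [v _ <-] <-]; rewrite setTI.
rewrite (_ : _ @^-1` _ =
  [set x | behead (prefix_of (size v).+1 x) == v :> seq A]).
  exact: (measurable_prefix_event _ (fun u => behead u == v :> seq A)).
rewrite cylinderE; apply/seteqP; split=> x /=; rewrite prefix_ofE.
  move=> <-; apply/eqP; rewrite size_mkseq /mkseq/= -[1%N]addn0 iotaDl -map_comp.
  by apply: eq_map.
move/eqP => {2}<-; rewrite /mkseq/= -[1%N]addn0 iotaDl -map_comp.
by apply: eq_map.
Qed.

Lemma measurable_preimage_shift (B : set (g_sigma_algebraType (@cylinders A))) :
  measurable B -> measurable ((@shift A @^-1` B) :
    set (g_sigma_algebraType (@cylinders A))).
Proof.
by move=> mB; have := measurable_shift measurableT _ mB; rewrite setTI.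
Qed.

Lemma iter_shift_preserving P (n : nat)
    (B : set (g_sigma_algebraType (@cylinders A))) :
  stationary P -> measurable B -> P (iter n (@shift A) @^-1` B) = P B.
Proof.
move=> sP; elim: n B => [//|n IH] B mB.
rewrite -(sP _ mB); apply: (IH (@shift A @^-1` B)).
exact: measurable_preimage_shift.
Qed.

(** The cylinders of the words [w ++ v] partition the preimage of the cylinder of [v] under [k]
    shifts, which by stationarity has the probability of [v]. *)
Lemma sum_word_prob_cat P (k : nat) v : stationary P ->
  \sum_(w : k.-tuple A) word_prob P (w ++ v) = word_prob P v.
Proof.
move=> sP; apply: EFin_inj; rewrite -sumEFin -word_probE.
under eq_bigr do rewrite -word_probE.
rewrite -(@iter_shift_preserving P k)//; last exact: measurable_cylinder.
apply/esym/measure_finType_partition.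
- by move=> a; exact: measurable_cylinder.
- move=> x; rewrite cylinderE/=; split=> [E|[w]].
    exists (prefix_of k x); rewrite cylinderE; apply: etrans.
      by rewrite size_cat size_tuple mkseqD.
    by rewrite E prefix_ofE.
  rewrite cylinderE/= size_cat => /mkseq_catP[_].
  by rewrite size_tuple.
- move=> w w' x; rewrite !cylinderE/= !size_cat => /mkseq_catP[+ _].
  move=> + /mkseq_catP[+ _]; rewrite !size_tuple => -> ww.
  exact: val_inj.
Qed.

End words.

(** * The ergodic theorem for visit frequencies *)

Section visit_frequency.
Context {d : measure_display} {T : measurableType d} {R : realType}.
Variables (P : probability T R) (f : T -> T).
Hypothesis f_measurable : forall B : set T, measurable B -> measurable (f @^-1` B).
Hypothesis f_preserving : forall B : set T, measurable B -> P (f @^-1` B) = P B.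
Hypothesis f_ergodic : forall B : set T, measurable B -> f @^-1` B = B ->
  P B = 0%E \/ P B = 1%E.
Implicit Types (B G : set T) (n k L M : nat) (x : T) (c : R).

Definition visits B n x : R := \sum_(i < n) \1_B (iter i f x).

Lemma visits0 B x : visits B 0 x = 0.
Proof. by rewrite /visits big_ord0. Qed.

Lemma visitsD B n k x : visits B (n + k) x = visits B n x + visits B k (iter n f x).
Proof.
rewrite /visits big_split_ord/=; congr (_ + _); apply: eq_bigr => i _.
by rewrite addnC iterD.
Qed.

Lemma visits1 B x : visits B 1 x = \1_B x.
Proof. by rewrite /visits big_ord1. Qed.

Lemma visits_ge0 B n x : 0 <= visits B n x.
Proof. by apply: sumr_ge0 => i _; rewrite indicE. Qed.

Lemma visits_le B G n x : B `<=` G -> visits B n x <= visits G n x.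
Proof.
move=> BG; apply: ler_sum => i _; rewrite !indicE ler_nat.
case: (boolP (iter i f x \in B)) => // /set_mem/BG/mem_set -> //.
Qed.

Lemma visitsC B n x : visits (~` B) n x = n%:R - visits B n x.
Proof.
apply/esym/eqP; rewrite subr_eq; apply/eqP; rewrite -big_split/= (eq_bigr (fun=> 1)) => [|i _].
  by rewrite sumr_const card_ord.
by rewrite indicC indicE; case: (_ \in B); rewrite /= ?add0r ?addr0.
Qed.

Lemma iter_measurable n B : measurable B -> measurable (iter n f @^-1` B).
Proof.
by elim: n B => // n IH B mB; apply: (IH (f @^-1` B)); exact: f_measurable.
Qed.

Lemma iter_preserving n B : measurable B -> P (iter n f @^-1` B) = P B.
Proof.
elim: n B => // n IH B mB; rewrite -(f_preserving B mB).
by apply: (IH (f @^-1` B)); exact: f_measurable.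
Qed.

Lemma measurable_visits B n : measurable B -> measurable_fun setT (visits B n).
Proof.
move=> mB; apply: measurable_sum => i.
by apply: (measurable_indic (U := iter i f @^-1` B)); exact: iter_measurable.
Qed.

Lemma measurable_visits_gt B n c : measurable B ->
  measurable [set x | c < visits B n x].
Proof.
move=> mB; rewrite (_ : mkset _ = visits B n @^-1` `]c, +oo[%classic).
  rewrite -[X in measurable X]setTI.
  exact: (measurable_visits B n mB measurableT _ (measurable_itv `]c, +oo[)).
by apply/seteqP; split=> x /=; rewrite in_itv/= andbT.
Qed.

Lemma integral_visits B n : measurable B ->
  (\int[P]_x (visits B n x)%:E)%E = (n%:R%:E * P B)%E.
Proof.
move=> mB; under eq_integral do rewrite /visits -sumEFin.
rewrite ge0_integral_sum//; last first.
  move=> i; apply/measurable_EFinP.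
  by apply: (measurable_indic (U := iter i f @^-1` B)); exact: iter_measurable.
rewrite (eq_bigr (fun=> P B)) => [|i _]; last first.
  rewrite -(iter_preserving i B mB) -[in RHS](setIT (iter i f @^-1` B)).
  exact: (integral_indic P measurableT (iter_measurable i B mB)).
rewrite -(fineK (fin_num_measure P B mB)) sumEFin.
by rewrite sumr_const card_ord -EFinM mulr_natl.
Qed.

(* Cut the orbit greedily into blocks of length at most M on each of which
   the frequency of visits is at least c. *)
Lemma visits_packing B G c M : 0 <= c <= 1 -> B `<=` G ->
  (forall x, ~ G x -> exists2 n, (0 < n <= M)%N & c * n%:R <= visits B n x) ->
  forall L x, c * (L%:R - M%:R) <= visits G L x.
Proof.
move=> /andP[c0 c1] BG good L; have [k] := ubnP L.
elim: k L => // k IH L; rewrite ltnS => Lk x.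
(* The slack [M] pays for the incomplete block at the end: for [L <= M] the left side is not
   positive. *)
have [LM|ML] := leqP L M.
  apply: le_trans (visits_ge0 _ _ _).
  by rewrite mulr_ge0_le0// subr_le0 ler_nat.
have L0 : (0 < L)%N by exact: leq_ltn_trans ML.
(* A point of [G] forms a block of length 1, whose visit counts 1, at least [c]; elsewhere the block
   is the one given by the hypothesis. *)
have [Gx|nGx] := pselect (G x).
  rewrite -(prednK L0) -add1n visitsD visits1 indicE mem_set//.
  have := IH L.-1 _ (iter 1 f x); rewrite prednK// => /(_ Lk).
  have : c * (1 + L.-1%:R - M%:R) = c + c * (L.-1%:R - M%:R) by ring.
  by rewrite natrD /= => -> H; exact: lerD.
have [n /andP[n0 nM] cn] := good x nGx.
have nL : (n <= L)%N by exact: leq_trans nM (ltnW ML).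
rewrite -(subnKC nL) visitsD.
have LnL : (L - n < k)%N.
  by apply: leq_trans Lk; rewrite -subn_gt0 subKn.
have := IH _ LnL (iter n f x); have := @visits_le B G n x BG.
have : c * (n%:R + (L - n)%:R - M%:R) = c * n%:R + c * ((L - n)%:R - M%:R) by ring.
by rewrite natrD => -> BGn H; apply: lerD => //; exact: le_trans BGn.
Qed.

(** Integrating the packing bound gives [c (L - M) <= L P(G)] for every [L], by invariance. If
    [P(G) = g < c], this fails as soon as [L (c - g)] exceeds [c M]. *)
Lemma packing_prob B G c M : measurable G -> 0 <= c <= 1 -> B `<=` G ->
  (forall x, ~ G x -> exists2 n, (0 < n <= M)%N & c * n%:R <= visits B n x) ->
  (c%:E <= P G)%E.
Proof.
move=> mG c01 BG good; have Gfin := fin_num_measure P G mG.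
rewrite -(fineK Gfin) lee_fin leNgt; apply/negP => gc.
have c0 : 0 <= c by case/andP: c01.
set g := fine (P G) in gc.
pose L := (Num.bound (c * M%:R / (c - g)) + M)%N.
have L1 : c * M%:R < L%:R * (c - g).
  rewrite -ltr_pdivrMr ?subr_gt0// /L natrD ltr_wpDr//.
  by apply: archi_boundP; rewrite divr_ge0 ?mulr_ge0// subr_ge0 ltW.
have ML : M%:R <= L%:R :> R by rewrite ler_nat leq_addl.
suff : c * (L%:R - M%:R) <= L%:R * g by move: L1; rewrite !mulrBr [c * L%:R]mulrC; lra.
rewrite -lee_fin [leRHS]EFinM (fineK Gfin) -(integral_visits G L mG).
have -> : (c * (L%:R - M%:R))%:E = (\int[P]_x (c * (L%:R - M%:R))%:E)%E.
  rewrite integral_cst// -[LHS]mule1; congr (_ * _)%E.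
  exact/esym/(probability_setT P).
apply: ge0_le_integral => //.
- by move=> x _; rewrite lee_fin mulr_ge0// subr_ge0.
- by apply/measurable_EFinP; exact: measurable_visits.
- by move=> x _; rewrite lee_fin; exact: (visits_packing B G c M c01 BG good L x).
Qed.

(** [bad M] collects the points whose first [M] averages all stay below [c]. Adding it to [B] makes
    packing possible with blocks of length at most [M], so [c <= P(B) + P(bad M)]; and [P(bad M)]
    tends to 0 because almost every point has some good [n]. *)
Lemma maximal_ergodic B c : measurable B -> 0 <= c <= 1 ->
  {ae P, forall x, exists2 n, (0 < n)%N & c * n%:R <= visits B n x} ->
  (c%:E <= P B)%E.
Proof.
move=> mB c01 bad0.
pose bad M := \bigcap_(n in [set n | (n < M)%N])
  ~` [set x | c * n.+1%:R <= visits B n.+1 x].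
have badE M x : bad M x <-> forall n, (0 < n <= M)%N -> visits B n x < c * n%:R.
  split=> [b [//|n] /andP[_ nM]|b n /= nM]; first by rewrite ltNge; apply/negP; exact: b.
  by apply/negP; rewrite -ltNge; exact: b.
have mbad M : measurable (bad M).
  apply: bigcap_measurableType => n _; apply: measurableC.
  rewrite (_ : mkset _ = \bigcap_k [set x | c * n.+1%:R - k.+1%:R^-1 < visits B n.+1 x]).
    by apply: bigcapT_measurable => k; exact: measurable_visits_gt.
  apply/seteqP; split=> x /= H.
    by move=> k _ /=; rewrite ltrBlDr (le_lt_trans H)// ltrDl invr_gt0.
  rewrite leNgt; apply/negP => /ltr_add_invr[k]; have := H k I => /=.
  by rewrite ltrBlDr => /lt_trans h /h; rewrite ltxx.
have lim : (P \o bad) M @[M --> \oo] --> 0%E.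
  have <- : P (\bigcap_M bad M) = 0%E.
    apply: measure_negligible; first exact: bigcapT_measurable.
    apply: negligibleS bad0 => x H [n n0]; apply/negP; rewrite -ltNge.
    by have /badE := H n I; apply; rewrite n0 leqnn.
  apply: nonincreasing_cvg_mu => //.
  - by rewrite (le_lt_trans (probability_le1 P (mbad 0%N)))// ltry.
  - exact: bigcapT_measurable.
  - move=> M N MN; apply/subsetPset => x /badE b; apply/badE => n /andP[n0 nM].
    by apply: b; rewrite n0 (leq_trans nM).
have le M : (c%:E <= P B + P (bad M))%E.
  apply: le_trans (measureU2 P mB (mbad M)).
  apply: (packing_prob B (B `|` bad M) c M) => //; first exact: measurableU.
  move=> x /not_orP[_ /badE/existsNP[n]].
  by move=> /not_implyP[nM /negP]; rewrite -leNgt => cn; exists n.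
have : (P B + P (bad M))%E @[M --> \oo] --> (P B + 0)%E.
  by apply: cvgeD => //; [exact: fin_num_adde_defl|exact: cvg_cst].
rewrite adde0 => lim2; rewrite -(cvg_lim _ lim2)//.
apply: lime_ge; last exact: nearW.
by apply/cvg_ex; exists (P B).
Qed.

(** For [c <= 1], the points without such a [K] form an invariant event. Were its probability 1,
    almost every orbit would have an average at least [c], and the maximal inequality would give
    [c <= P(B)]; by ergodicity it is null. *)
Lemma ae_visits_le B c : measurable B -> (P B < c%:E)%E ->
  {ae P, forall x, exists K : nat, forall n, visits B n x <= c * n%:R + K%:R}.
Proof.
move=> mB Bc; have PB0 : (0 <= P B)%E by [].
have c0 : 0 <= c by rewrite -lee_fin ltW// (le_lt_trans PB0).
have [c1|c1] := leP c 1; last first.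
  apply: nearW => x; exists 0%N => n; rewrite addr0.
  apply: (@le_trans _ _ n%:R); last by rewrite ler_peMl// ltW.
  by rewrite -subr_ge0 -visitsC visits_ge0.
(* The event that visits B n x - c n is unbounded is exactly invariant. *)
pose E := \bigcap_(K : nat) \bigcup_n [set x | c * n%:R + K%:R < visits B n x].
have mE : measurable E.
  apply: bigcapT_measurable => K; apply: bigcupT_measurable => n.
  exact: measurable_visits_gt.
have visitsS n x : visits B n.+1 x = \1_B x + visits B n (f x).
  by rewrite -add1n visitsD visits1.
have ind01 x : 0 <= (\1_B x : R) <= 1 by rewrite indicE ler0n lern1 leq_b1.
have fE : f @^-1` E = E.
  (* Passing between [x] and [f x] shifts [n] by one, which changes the count and [c n] by at most 1
     each; starting from [K.+1] absorbs this. *)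
  apply/seteqP; split=> x Ex K _; have [n _ /= H] := Ex K.+1 I.
    exists n.+1 => //=; rewrite visitsS; have := ind01 x.
    by move: H; rewrite -[K.+1%:R]natr1 -[n.+1%:R]natr1 mulrDr mulr1; lra.
  case: n H => [|n] H.
    by exfalso; move: H; rewrite visits0 mulr0 add0r ltNge ler0n.
  exists n => //=; move: H; rewrite visitsS; have := ind01 x.
  by rewrite -[K.+1%:R]natr1 -[n.+1%:R]natr1 mulrDr mulr1; lra.
have [E0|E1] := f_ergodic E mE fE.
  exists E; split=> // x /= H K _; apply: contrapT => nK; apply: H; exists K => n.
  by rewrite leNgt; apply/negP => H; apply: nK; exists n.
have : (c%:E <= P B)%E.
  apply: maximal_ergodic => //; first by rewrite c0.
  exists (~` E); split; first exact: measurableC.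
    by rewrite probability_setC// E1 subee.
  move=> x /= H Ex; apply: H; have [n _ /= cn] := Ex 0%N I.
  rewrite addr0 in cn; exists n; last exact: ltW.
  by case: n cn => //; rewrite visits0 mulr0 ltxx.
by rewrite leNgt Bc.
Qed.

Lemma cvg_freq_bound (u : R^nat) (p : R) :
  (forall k, exists K : nat, forall n,
    `|u n - p * n%:R| <= k.+1%:R^-1 * n%:R + K%:R) ->
  u n / n%:R @[n --> \oo] --> p.
Proof.
move=> H; apply/cvgrPdist_lt => e e0.
have e20 : 0 < e / 2 by rewrite divr_gt0.
have [k ke] := ltr_add_invr e20; rewrite add0r in ke.
have [K HK] := H k.
exists (Num.bound (K%:R / (e / 2))).+1 => // n /= nB.
have n0 : (0 < n%:R :> R) by rewrite ltr0n (leq_trans _ nB).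
have Kn : K%:R < e / 2 * n%:R.
  rewrite mulrC -ltr_pdivrMr//; apply: lt_le_trans (archi_boundP _) _.
    by rewrite divr_ge0// ltW.
  by rewrite ler_nat ltnW.
rewrite distrC -(mulfK (lt0r_neq0 n0) p) -mulrBl normrM.
rewrite (gtr0_norm (_ : 0 < n%:R^-1)) ?invr_gt0// ltr_pdivrMr//.
apply: le_lt_trans (HK n) _; rewrite [e]splitr mulrDl ler_ltD//.
by rewrite ler_wpM2r// ltW.
Qed.

(** The upper bound is applied to [B] and to its complement, where it becomes a lower bound for [B].
    Countably many slopes are used, so the exceptional sets together remain null. *)
Lemma ae_cvg_visits B : measurable B ->
  {ae P, forall x, visits B n x / n%:R @[n --> \oo] --> fine (P B)}.
Proof.
move=> mB; have PB : (fine (P B))%:E = P B by rewrite fineK// fin_num_measure.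
have PC : P (~` B) = (1 - fine (P B))%:E.
  by rewrite probability_setC// -PB.
have k0 k : 0 < k.+1%:R^-1 :> R by rewrite invr_gt0.
have up : {ae P, forall x, forall k, exists K : nat, forall n,
    visits B n x <= (fine (P B) + k.+1%:R^-1) * n%:R + K%:R}.
  apply: ae_foralln => k; apply: ae_visits_le => //.
  by rewrite -PB lte_fin ltrDl.
have dn : {ae P, forall x, forall k, exists K : nat, forall n,
    visits (~` B) n x <= (1 - fine (P B) + k.+1%:R^-1) * n%:R + K%:R}.
  apply: ae_foralln => k; apply: ae_visits_le; first exact: measurableC.
  by rewrite PC lte_fin ltrDl.
apply: filterS2 up dn => x up dn; apply: cvg_freq_bound => k.
have [K1 H1] := up k; have [K2 H2] := dn k; exists (K1 + K2)%N => n.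
have := H1 n; have := H2 n; rewrite visitsC natrD ler_norml.
have := ler0n R K1; have := ler0n R K2.
set a := k.+1%:R^-1; set p := fine _; rewrite !mulrDl mulNr mul1r.
by move=> *; apply/andP; split; lra.
Qed.
End visit_frequency.

(** * The Kraft-McMillan inequality *)

Section kraft_mcmillan.
Context {R : realType} {T : finType}.
Variable c : T -> seq bool.

(** Group the words by length: there are at most [2 ^ n] distinct ones of length [n], so each of the
    [N.+1] lengths contributes at most 1. *)
Lemma sum_exp_size_le (I : finType) (W : I -> seq bool) (N : nat) :
  injective W -> (forall i, size (W i) <= N)%N ->
  \sum_i (2^-1 : R) ^+ size (W i) <= N.+1%:R.
Proof.
move=> injW sizeW.
rewrite (partition_big (fun i => inord (size (W i)) : 'I_N.+1) xpredT)//=.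
apply: le_trans (_ : \sum_(n < N.+1) (1 : R) <= _); last first.
  by rewrite sumr_const card_ord.
apply: ler_sum => n _.
rewrite (eq_bigl (fun i => size (W i) == n)) => [|i]; last first.
  by rewrite -val_eqE/= inordK ?ltnS.
rewrite (eq_bigr (fun=> (2^-1 : R) ^+ n)) => [|i /eqP -> //].
rewrite sumr_const exprVn -[leLHS]mulr_natl ler_pdivrMr ?exprn_gt0// mul1r.
rewrite -natrX ler_nat.
have <- : #|{: n.-tuple bool}| = (2 ^ n)%N by rewrite card_tuple card_bool.
rewrite -(card_in_imset (f := fun i => insubd (nseq_tuple n true) (W i)
  : n.-tuple bool)) => [|i j]; first exact: max_card.
rewrite !unfold_in => /eqP si /eqP sj E; apply: injW.
have := congr1 val E; rewrite !val_insubd.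
by rewrite si sj eqxx.
Qed.

Lemma bernoulli_ineq (e : R) (r : nat) : 0 <= e -> 1 + r%:R * e <= (1 + e) ^+ r.
Proof.
move=> e0; elim: r => [|r IH]; first by rewrite mul0r addr0 expr0.
rewrite exprS (@le_trans _ _ ((1 + e) * (1 + r%:R * e)))//.
  rewrite -natr1; have : 0 <= r%:R * e * e by rewrite !mulr_ge0.
  by nra.
by rewrite ler_wpM2l// addr_ge0.
Qed.

Lemma le1_of_expr_le (S : R) (N : nat) : 0 <= S ->
  (forall r, (0 < r)%N -> S ^+ r <= (r * N).+1%:R) -> S <= 1.
Proof.
move=> S0 H; rewrite leNgt; apply/negP => S1.
pose e := S - 1; have e0 : 0 < e by rewrite subr_gt0.
(* With exponent [2 r], Bernoulli's inequality squared gives [(1 + r e)^2], quadratic in [r]; this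
   [r] makes [(r e)^2] exceed [2 r N]. *)
pose r := (Num.bound (2 * N%:R / (e * e))).+1.
have rE : 2 * N%:R < r%:R * (e * e).
  rewrite -ltr_pdivrMr ?mulr_gt0//; apply: lt_trans (archi_boundP _) _.
    by rewrite divr_ge0// ?mulr_ge0// ltW.
  by rewrite ltr_nat.
have := H (r * 2)%N isT; rewrite exprM.
have Bn : 1 + r%:R * e <= S ^+ r.
  have -> : S = 1 + e by rewrite addrC subrK.
  by apply: bernoulli_ineq; exact: ltW.
rewrite -natr1 !natrM.
have r0 : 0 < r%:R :> R by rewrite ltr0n.
have re0 : 0 < r%:R * e by rewrite mulr_gt0.
rewrite leNgt => /negP; apply.
apply: (@lt_le_trans _ _ ((1 + r%:R * e) ^+ 2)); last first.
  by rewrite ler_pXn2r// nnegrE ?exprn_ge0// addr_ge0// ltW.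
rewrite [1 + _]addrC sqrrD1 exprMn.
have : r%:R * (2 * N%:R) < r%:R * (r%:R * (e * e)) by rewrite ltr_pM2l.
by move: (r%:R) (N%:R) r0 re0 => a b; nra.
Qed.

(** McMillan's argument: [S ^+ r] expands into a sum over the concatenations of [r] codewords, which
    unique decoding makes distinct and whose lengths are at most [r N]. Hence [S ^+ r] grows at most
    linearly in [r], so [S <= 1]. *)
Lemma kraft_mcmillan :
  (forall us vs : seq T, us != [::] -> vs != [::] ->
    flatten (map c us) = flatten (map c vs) -> us = vs) ->
  \sum_u (2^-1 : R) ^+ size (c u) <= 1.
Proof.
move=> dec; set S := (X in X <= _).
have S0 : 0 <= S by apply: sumr_ge0 => u _; rewrite exprn_ge0.
pose N := (\max_u size (c u))%N.
apply: (@le1_of_expr_le S N S0) => r r0.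
pose W (g : {ffun 'I_r -> T}) := flatten (map c (map g (enum 'I_r))).
have sizeW g : size (W g) = (\sum_i size (c (g i)))%N.
  by rewrite size_flatten /shape -!map_comp sumnE big_map.
have -> : S ^+ r = \sum_g (2^-1) ^+ size (W g).
  have -> : S ^+ r = \prod_(i < r) S by rewrite prodr_const card_ord.
  rewrite bigA_distr_bigA/=; apply: eq_bigr => g _.
  by rewrite sizeW expr_sum.
apply: sum_exp_size_le => [g h /dec|g].
  have nnil (k : 'I_r -> T) : map k (enum 'I_r) != [::].
    by rewrite -size_eq0 size_map size_enum_ord -lt0n.
  move=> /(_ (nnil _) (nnil _)) E; apply/ffunP => i.
  by have /eq_in_map/(_ i) := E; apply; rewrite mem_enum.
rewrite sizeW -[X in (_ <= X * _)%N]card_ord -sum_nat_const.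
by apply: leq_sum => i _; exact: leq_bigmax.
Qed.
End kraft_mcmillan.

(** * Likelihood of a Markov source *)

Lemma occurrences_short (A : eqType) (x w : seq A) :
  (size x < size w)%N -> occurrences x w = 0%N.
Proof.
move=> xw; rewrite /occurrences; apply: big_geq.
by rewrite leqn0 subn_eq0.
Qed.

(** The new letter creates one new window, the last one; the earlier windows do not reach it. *)
Lemma occurrences_rcons (A : eqType) (x w : seq A) (b : A) :
  (size w <= (size x).+1)%N ->
  occurrences (rcons x b) w =
  (occurrences x w + (drop ((size x).+1 - size w) (rcons x b) == w))%N.
Proof.
move=> wx; rewrite /occurrences size_rcons subSn// big_nat_recr//=; congr (_ + _)%N.
  apply: eq_big_nat => i /andP[_ ix]; rewrite drop_rcons; last first.
    by rewrite -ltnS (leq_trans ix)// leq_subr.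
  by rewrite -cats1 takel_cat// size_drop; move: ix wx; clear; lia.
by rewrite take_oversize// size_drop size_rcons subKn.
Qed.

Section likelihood.
Context {R : realType} {A : alphabetType}.
Implicit Types (P : source R A) (x v w : seq A) (a b : A).

Lemma cond_prob_ge0 P v a : 0 <= cond_prob P v a.
Proof. by rewrite divr_ge0 ?word_prob_ge0. Qed.

Lemma word_prob_rcons_le P v a : word_prob P (rcons v a) <= word_prob P v.
Proof.
rewrite -(sum_word_prob_rcons P v) (bigD1 a)//= lerDl.
by apply: sumr_ge0 => b _; exact: word_prob_ge0.
Qed.

Lemma word_prob_le1 P v : word_prob P v <= 1.
Proof.
elim/last_ind: v => [|v a IH]; first by rewrite word_prob_nil.
exact: le_trans (word_prob_rcons_le P v a) IH.
Qed.

Lemma word_prob_rcons P v a :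
  word_prob P (rcons v a) = word_prob P v * cond_prob P v a.
Proof.
rewrite /cond_prob; have [v0|v0] := eqVneq (word_prob P v) 0; last first.
  by rewrite mulrCA divff// mulr1.
rewrite v0 mul0r; apply/eqP; rewrite eq_le word_prob_ge0 -v0 andbT.
exact: word_prob_rcons_le.
Qed.

Lemma sum_cond_prob P v : word_prob P v != 0 -> \sum_a cond_prob P v a = 1.
Proof. by move=> v0; rewrite -mulr_suml sum_word_prob_rcons divff. Qed.

Lemma sum_cond_prob_le1 P v : \sum_a cond_prob P v a <= 1.
Proof.
have [v0|v0] := eqVneq (word_prob P v) 0; last by rewrite sum_cond_prob.
by rewrite big1// => a _; rewrite /cond_prob v0 invr0 mulr0.
Qed.

Lemma word_prob_cat_le P w v : stationary P ->
  word_prob P (w ++ v) <= word_prob P v.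
Proof.
move=> sP; rewrite -(sum_word_prob_cat P (size w) v sP).
rewrite (bigD1 (in_tuple w))//= lerDl.
by apply: sumr_ge0 => z _; exact: word_prob_ge0.
Qed.

(** The Markov condition compares pasts of equal length, not [w] with its suffix [v]. Summing
    [P(z v a) = P(z v) P(a|w)] over all [z] of length [k] gives [P(v a) = P(v) P(a|w)] by
    stationarity. *)
Lemma markov_word_prob_rcons P (m : nat) w a : markov_sources m P ->
  (m <= size w)%N -> 0 < word_prob P w ->
  word_prob P (rcons w a) =
  word_prob P w * cond_prob P (drop (size w - m) w) a.
Proof.
move=> [[sP eP] mP] mw w0; rewrite word_prob_rcons; congr (_ * _).
set v := drop _ _; have sv : size v = m by rewrite size_drop subKn.
set k := (size w - m)%N in v sv *.
have wE : w = take k w ++ v by rewrite cat_take_drop.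
have v0 : 0 < word_prob P v.
  by apply: lt_le_trans w0 _; rewrite wE word_prob_cat_le.
apply: (mulfI (lt0r_neq0 v0)); rewrite -word_prob_rcons.
rewrite -(sum_word_prob_cat P k (rcons v a) sP) -(sum_word_prob_cat P k v sP).
rewrite mulr_suml; apply: eq_bigr => z _; rewrite -rcons_cat (word_prob_rcons P (z ++ v)).
have [->|z0] := eqVneq (word_prob P (z ++ v)) 0; first by rewrite !mul0r.
have szv : size (z ++ v) == size w.
  by rewrite size_cat size_tuple sv subnK.
congr (_ * _).
apply/esym/(mP (size w) (Tuple szv) (in_tuple w) a mw) => //=.
  by rewrite lt0r z0 word_prob_ge0.
by rewrite drop_size_cat// size_tuple.
Qed.

(** Induction on [x]: a letter [b] after the context [v0] of the last [m] letters multiplies the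
    probability by a transition probability and adds one occurrence of [v0 b]. The probability of
    the first [m] letters, at most 1, is dropped, hence an inequality. The first conjunct is the
    support condition for Gibbs' inequality. *)
Lemma markov_likelihood P (m : nat) x : markov_sources m P ->
  (m <= size x)%N -> 0 < word_prob P x ->
  (forall (v : m.-tuple A) a,
     (0 < occurrences x (rcons v a))%N -> cond_prob P v a != 0) /\
  ln (word_prob P x) <= \sum_(v : m.-tuple A) \sum_a
    (occurrences x (rcons v a))%:R * ln (cond_prob P v a).
Proof.
move=> mP; elim/last_ind: x => [|x b IH].
  rewrite leqn0 => /eqP m0 _; split=> [v a|]; first by rewrite occurrences_short ?size_rcons.
  rewrite word_prob_nil ln1 big1// => v _; rewrite big1// => a _.
  by rewrite occurrences_short ?size_rcons// mul0r.
rewrite size_rcons leq_eqVlt => /predU1P[mE _|].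
  have occ0 (v : m.-tuple A) a : occurrences (rcons x b) (rcons v a) = 0%N.
    by rewrite occurrences_short// !size_rcons size_tuple -mE.
  split=> [v a|]; first by rewrite occ0.
  rewrite big1 ?ln_le0 ?word_prob_le1// => v _; rewrite big1// => a _.
  by rewrite occ0 mul0r.
rewrite ltnS => mx xb0.
have x0 : 0 < word_prob P x by exact: lt_le_trans (word_prob_rcons_le P x b).
have [IHpos IHle] := IH mx x0.
have st : size (drop (size x - m) x) == m by rewrite size_drop subKn.
pose v0 := Tuple st.
have xbE : word_prob P (rcons x b) = word_prob P x * cond_prob P v0 b.
  exact: markov_word_prob_rcons.
have q0 : 0 < cond_prob P v0 b by rewrite -(pmulr_rgt0 _ x0) -xbE.
have occE (v : m.-tuple A) a : occurrences (rcons x b) (rcons v a) =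
    (occurrences x (rcons v a) + ((v == v0) && (a == b)))%N.
  rewrite occurrences_rcons size_rcons size_tuple// subSS drop_rcons ?leq_subr//.
  by rewrite eqseq_rcons eq_sym [b == a]eq_sym.
split=> [v a|].
  rewrite occE; case: (boolP (_ && _)) => [/andP[/eqP -> /eqP ->] _|_].
    exact: lt0r_neq0.
  by rewrite addn0; exact: IHpos.
rewrite xbE lnM ?posrE//; under eq_bigr do under eq_bigr do rewrite occE natrD mulrDl.
under eq_bigr do rewrite big_split/=.
rewrite big_split/= lerD//.
rewrite (bigD1 v0)//= (bigD1 b)//= !eqxx mul1r big1 ?addr0 => [|a /negbTE ->].
  rewrite big1 ?addr0// => v /negbTE ->.
  by rewrite big1// => a _; rewrite mul0r.
by rewrite andbF mul0r.
Qed.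

Lemma ln2_gt0 : 0 < ln (2 : R).
Proof. by rewrite ln_gt0// ltr1n. Qed.

(** The right side is minus the log-likelihood of [x], in nats, under its own empirical transition
    probabilities. *)
Lemma empirical_entropyE (m t : nat) (x : t.-tuple A) :
  (m < t)%N ->
  (t - m)%:R * empirical_entropy m x * ln 2 =
  - \sum_(v : m.-tuple A) \sum_a (occurrences x (rcons v a))%:R *
      ln ((occurrences x (rcons v a))%:R / (ctx_occurrences x v)%:R : R).
Proof.
move=> mt; have tm0 : (t - m)%:R != 0 :> R by rewrite pnatr_eq0 -lt0n subn_gt0.
rewrite /empirical_entropy mulrN mulNr mulr_sumr mulr_suml; congr (- _).
apply: eq_bigr => w _; rewrite mulrA mulrCA divff// mulr1.
rewrite mulr_sumr mulr_suml; apply: eq_bigr => a _; rewrite /log2.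
have [c0|c0] := eqVneq (ctx_occurrences x w) 0%N.
  have /eqP : occurrences x (rcons w a) = 0%N.
    by apply/eqP; move/eqP: c0; rewrite /ctx_occurrences sum_nat_eq0 => /forallP/(_ a).
  by rewrite c0 => /eqP ->; rewrite !mul0r.
set q := _ / _; rewrite mulrA [in LHS]mulrA divfK ?lt0r_neq0 ?ln2_gt0//.
by rewrite mulrCA divff ?pnatr_eq0// mulr1.
Qed.

Lemma sum_ctx_ratio (v x : seq A) : ctx_occurrences x v != 0%N ->
  \sum_a (occurrences x (rcons v a))%:R / (ctx_occurrences x v)%:R = 1 :> R.
Proof. by move=> c0; rewrite -mulr_suml -natr_sum divff// pnatr_eq0. Qed.

Lemma markov_prob_le P (m t : nat) (x : t.-tuple A) : markov_sources m P ->
  (m < t)%N -> 0 < word_prob P x ->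
  ln (word_prob P x) <= - ((t - m)%:R * empirical_entropy m x * ln 2).
Proof.
move=> mP mt x0; have mx : (m <= size x)%N by rewrite size_tuple ltnW.
have [qpos /le_trans] := markov_likelihood P m x mP mx x0; apply.
rewrite empirical_entropyE// opprK; apply: ler_sum => v _.
have [c0|c0] := eqVneq (ctx_occurrences x v) 0%N.
  have occ0 a : occurrences x (rcons v a) = 0%N.
    apply/eqP; move/eqP: c0.
    by rewrite /ctx_occurrences sum_nat_eq0 => /forallP/(_ a).
  by rewrite !big1// => a _; rewrite occ0 mul0r.
set c : R := (ctx_occurrences x v)%:R.
have cpos : 0 < c by rewrite ltr0n lt0n.
have nE a : (occurrences x (rcons v a))%:R =
    c * ((occurrences x (rcons v a))%:R / c) by rewrite mulrC divfK ?gt_eqF.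
under eq_bigr do rewrite nE -mulrA.
under [leRHS]eq_bigr do rewrite [X in X * _]nE -mulrA.
rewrite -!mulr_sumr ler_pM2l//; apply: gibbs.
- by move=> a; rewrite divr_ge0.
- by move=> a; exact: cond_prob_ge0.
(* A letter of transition probability 0 never follows [v] in [x], because [x] has positive
   probability. *)
- move=> a q0; have := qpos v a; rewrite q0 eqxx lt0n.
  by case: eqP => [->|_ /(_ isT)//]; rewrite mul0r.
- by rewrite sum_ctx_ratio// sum_cond_prob_le1.
Qed.

(** * The Type I error *)

Lemma reject_prob_le (m : nat) (alpha : R) (phi : block_map A) P (t : nat) :
  0 < alpha -> is_code phi -> markov_sources m P -> (m < t)%N ->
  (reject_prob m alpha phi P t <= alpha%:E)%E.
Proof.
move=> a0 code mP mt; rewrite /reject_prob.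
rewrite (prefix_event_prob P t (fun u => ~~ accepts m alpha phi u)) lee_fin.
apply: (@le_trans _ _ (\sum_(u : t.-tuple A) alpha * 2^-1 ^+ size (phi t u))).
  rewrite big_mkcond; apply: ler_sum => u _.
  have rhs0 : 0 <= alpha * 2^-1 ^+ size (phi t u).
    by rewrite mulr_ge0 ?exprn_ge0// ltW.
  case: ifP => //; rewrite /accepts -ltNge => rej.
  have [->//|u0] := eqVneq (word_prob P u) 0.
  have upos : 0 < word_prob P u by rewrite lt0r u0 word_prob_ge0.
  rewrite -ler_ln ?posrE// ?mulr_gt0 ?exprn_gt0// ?invr_gt0//.
  apply: le_trans (markov_prob_le P m t u mP mt upos) _.
  rewrite lnM ?posrE ?exprn_gt0 ?invr_gt0// lnXn ?invr_gt0// lnV ?posrE//.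
  move: rej; rewrite /log2 div1r lnV ?posrE// ltr_pdivrMr ?ln2_gt0//.
  by rewrite mulrBl mulNrn -mulr_natl; lra.
rewrite -mulr_sumr ler_piMr//; first exact: ltW.
have t0 : (0 < t)%N by exact: leq_ltn_trans mt.
by have [_ dec] := code t t0; exact: (kraft_mcmillan (phi t) dec).
Qed.
End likelihood.

(** * Convergence of the empirical entropy *)

Section empirical_limit.
Context {R : realType} {A : alphabetType}.
Implicit Types (P : source R A) (x : nat -> A) (v w : seq A) (a : A).

(** A sample of length [n + m] has exactly [n] windows of length [m + 1], and the window at [i]
    equals [w] when the [i]-th shift of [x] lies in the cylinder. *)
Lemma occurrences_visits (m n : nat) x w : size w = m.+1 ->
  (occurrences (prefix_of (n + m) x) w)%:R =
  visits (T := g_sigma_algebraType (@cylinders A)) (R := R) (@shift A)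
    (cylinder w) n x.
Proof.
move=> sw; rewrite /occurrences size_tuple sw subSS addnK /visits natr_sum big_mkord.
apply: eq_bigr => i _; rewrite indicE prefix_ofE; congr (nat_of_bool _)%:R.
have -> : drop i (mkseq x (n + m)) = mkseq (iter i (@shift A) x) (n + m - i).
  by rewrite -{1}(subnKC (_ : i <= n + m)%N) ?mkseqD ?drop_size_cat ?size_mkseq//;
    rewrite (leq_trans (ltnW (ltn_ord i)))// leq_addr.
have mi : (m.+1 <= n + m - i)%N by have := ltn_ord i; lia.
rewrite -(subnKC mi) mkseqD take_size_cat ?size_mkseq//.
apply/eqP/idP => [E|/set_mem]; last by rewrite cylinderE/= sw.
by apply/mem_set; rewrite cylinderE/= sw.
Qed.

Lemma ae_cvg_occurrences P w (m : nat) : M_infty P -> size w = m.+1 ->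
  {ae P, forall x, (occurrences (prefix_of (n + m) x) w)%:R / n%:R
    @[n --> \oo] --> word_prob P w}.
Proof.
move=> [sP eP] sw.
have := ae_cvg_visits P (@shift A) measurable_preimage_shift
  sP eP (cylinder w) (measurable_cylinder w).
by apply: filterS => x; under eq_fun do rewrite -(occurrences_visits m _ x w sw).
Qed.

Lemma cvg_sum (I : finType) (f : I -> R^nat) (l : I -> R) :
  (forall i, f i n @[n --> \oo] --> l i) ->
  \sum_i f i n @[n --> \oo] --> \sum_i l i.
Proof.
move=> fl; elim: (index_enum I) => [|i r IH].
  by rewrite big_nil; under eq_fun do rewrite big_nil; exact: cvg_cst.
by rewrite big_cons; under eq_fun do rewrite big_cons; exact: cvgD.
Qed.

(** When the limit total is 0 the ratios need not converge; the inner sum is then only bounded, by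
    [|q ln q| <= 1] for each letter, and the outer factor tends to 0. *)
Lemma cvg_plogp (f : A -> R^nat) (p : A -> R) :
  (forall a n, 0 <= f a n) -> (forall a, f a n @[n --> \oo] --> p a) ->
  (\sum_a f a n) *
    (\sum_a f a n / (\sum_b f b n) * log2 (f a n / (\sum_b f b n))) @[n --> \oo] -->
  (\sum_a p a) * (\sum_a p a / (\sum_b p b) * log2 (p a / (\sum_b p b))).
Proof.
move=> f0 fp; set s := \sum_b p b.
have sc : (\sum_b f b n) @[n --> \oo] --> s.
  by apply: cvg_sum => b; exact: fp.
have [s0|s0] := eqVneq s 0; last first.
  apply: cvgM => //; apply: cvg_sum => a.
  rewrite /log2 mulrA; under eq_fun do rewrite mulrA.
  apply: cvgM; last exact: cvg_cst.
  apply: (cvg_xlnx (fun n => f a n / \sum_b f b n)) => [n|].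
    by rewrite divr_ge0// sumr_ge0.
  by apply: cvgM => //; exact: cvgV.
rewrite s0 mul0r; apply/norm_cvg0P.
pose M : R := \sum_(a : A) (ln 2)^-1.
apply: (@squeeze_cvgr _ _ _ _ (fun=> 0) (fun n => (\sum_b f b n) * M)).
- apply: nearW => n; rewrite normr_ge0/= normrM ger0_norm ?sumr_ge0//.
  rewrite ler_wpM2l ?sumr_ge0// (le_trans (ler_norm_sum _ _ _))//.
  apply: ler_sum => a _; rewrite /log2 mulrA normrM.
  rewrite [`|(ln 2)^-1|]gtr0_norm ?invr_gt0 ?ln2_gt0//.
  rewrite ler_piMl ?invr_ge0 ?(ltW ln2_gt0)// norm_xlnx_le1//.
  rewrite divr_ge0 ?sumr_ge0//=.
  have [S0|S0] := eqVneq (\sum_b f b n) 0; first by rewrite S0 invr0 mulr0.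
  rewrite ler_pdivrMr ?mul1r; last by rewrite lt0r S0 sumr_ge0.
  by rewrite (bigD1 a)//= lerDl sumr_ge0.
- exact: cvg_cst.
- by have := cvgM sc (cvg_cst M); rewrite s0 mul0r; exact.
Qed.

Lemma ae_cvg_empirical_entropy P (m : nat) : M_infty P ->
  {ae P, forall x, empirical_entropy m (prefix_of t x) @[t --> \oo] -->
    entropy P m}.
Proof.
move=> MP.
have : {ae P, forall x, forall v : m.-tuple A, forall a,
    (occurrences (prefix_of (n + m) x) (rcons v a))%:R / n%:R
    @[n --> \oo] --> word_prob P (rcons v a)}.
  apply: (@filter_forall _ _ _ (almost_everywhere P)) => v.
  apply: (@filter_forall _ _ _ (almost_everywhere P)) => a.
  by apply: ae_cvg_occurrences => //; rewrite size_rcons size_tuple.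
have FF : Filter (almost_everywhere P) := ae_filter_ringOfSetsType P.
apply: (@filterS _ _ FF) => x H.
(* Reindexing by [t = n + m] makes the denominator [t - m] equal to the number [n] of windows. *)
rewrite -(cvg_shiftn m) /entropy.
apply: cvgN; apply: cvg_sum => v.
rewrite /cond_prob -(sum_word_prob_rcons P v).
pose f a n : R := (occurrences (prefix_of (n + m) x) (rcons v a))%:R / n%:R.
have f0 a n : 0 <= f a n by rewrite divr_ge0.
apply: cvg_trans (cvg_plogp f (fun a => word_prob P (rcons v a)) f0 (H v)).
apply: near_eq_cvg; exists 1%N => // n /= n0.
rewrite /f -mulr_suml -natr_sum addnK; congr (_ * _); apply: eq_bigr => a _.
have -> : forall c d : R, c / n%:R / (d / n%:R) = c / d.
  by move=> c d; rewrite invf_div mulrA mulrVK// unitfE pnatr_eq0 -lt0n.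
by [].
Qed.
End empirical_limit.

(** * Conditional entropies *)

Lemma sum_cat_tuple (V : nmodType) (A : finType) (j m : nat)
    (F : (j + m).-tuple A -> V) :
  \sum_(u : (j + m).-tuple A) F u =
  \sum_(w : j.-tuple A) \sum_(v : m.-tuple A) F (cat_tuple w v).
Proof.
rewrite pair_big/=.
pose h (wv : j.-tuple A * m.-tuple A) := cat_tuple wv.1 wv.2.
rewrite (reindex h)//=; apply/onW_bij/inj_card_bij.
  move=> [w v] [w' v'] /(congr1 val)/= /eqP.
  by rewrite eqseq_cat ?size_tuple// => /andP[/eqP/val_inj -> /eqP/val_inj ->].
by rewrite card_prod !card_tuple expnD.
Qed.

Section conditional_entropy.
Context {R : realType} {A : alphabetType}.
Implicit Types (P : source R A) (v w : seq A) (a : A).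

Lemma entropyE P (k : nat) : entropy P k * ln 2 =
  - \sum_(v : k.-tuple A) \sum_a word_prob P (rcons v a) * ln (cond_prob P v a).
Proof.
rewrite /entropy mulNr mulr_suml; congr (- _); apply: eq_bigr => v _.
rewrite mulr_sumr mulr_suml; apply: eq_bigr => a _.
by rewrite word_prob_rcons /log2; field; rewrite lt0r_neq0// ln2_gt0.
Qed.

Lemma cond_prob_le1 P v a : cond_prob P v a <= 1.
Proof.
apply: le_trans (sum_cond_prob_le1 P v); rewrite (bigD1 a)//= lerDl.
by apply: sumr_ge0 => b _; exact: cond_prob_ge0.
Qed.

Lemma entropy_ge0 P k : 0 <= entropy P k.
Proof.
rewrite -(pmulr_lge0 _ (@ln2_gt0 R)) entropyE oppr_ge0.
apply: sumr_le0 => v _; apply: sumr_le0 => a _.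
by rewrite mulr_ge0_le0 ?word_prob_ge0// ln_le0// cond_prob_le1.
Qed.

(** By stationarity [P(v a)] is the sum of [P(w v a)] over [w] of length [j]. This puts the entropy
    of order [m] on the same words as the entropy of order [j + m], so that the two can be
    compared. *)
Lemma entropy_suffixE P (j m : nat) : stationary P -> entropy P m * ln 2 =
  - \sum_(u : (j + m).-tuple A) \sum_a
      word_prob P (rcons u a) * ln (cond_prob P (drop j u) a).
Proof.
move=> sP; rewrite entropyE sum_cat_tuple; congr (- _); rewrite [RHS]exchange_big/=.
apply: eq_bigr => v _; rewrite [RHS]exchange_big/=; apply: eq_bigr => a _.
rewrite -(sum_word_prob_cat P j (rcons v a) sP) mulr_suml; apply: eq_bigr => w _.
by rewrite rcons_cat drop_size_cat ?size_tuple.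
Qed.

Section suffix.
Variables (P : source R A) (j m : nat).
Hypothesis P_stationary : stationary P.

Let p (ua : (j + m).-tuple A * A) := word_prob P (rcons ua.1 ua.2).
(** These weights keep the law of the first [j + m] letters and draw the last one from the
    transition probabilities given the preceding [m] letters only. *)
Let q (ua : (j + m).-tuple A * A) :=
  word_prob P ua.1 * cond_prob P (drop j ua.1) ua.2.

Let p_ge0 ua : 0 <= p ua. Proof. exact: word_prob_ge0. Qed.

Let q_ge0 ua : 0 <= q ua.
Proof. by rewrite mulr_ge0 ?word_prob_ge0 ?cond_prob_ge0. Qed.

(** If [a] has probability 0 after the last [m] letters of [u], it has probability 0 after [u], by
    stationarity. *)
Let q_eq0 ua : q ua = 0 -> p ua = 0.
Proof.
case: ua => u a; rewrite /p/= => /eqP; rewrite mulf_eq0/= => /orP[/eqP u0|/eqP c0].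
  by rewrite word_prob_rcons u0 mul0r.
apply/eqP; rewrite eq_le word_prob_ge0 andbT -[in leRHS](mulr0 (word_prob P (drop j u))).
rewrite -{1}(cat_take_drop j u) -c0 -word_prob_rcons rcons_cat.
exact: word_prob_cat_le.
Qed.

Let sum_q_le : \sum_ua q ua <= \sum_ua p ua.
Proof.
rewrite -!(pair_bigA _ (fun u a => q (u, a))) -!(pair_bigA _ (fun u a => p (u, a)))/=.
apply: ler_sum => u _; rewrite /q /p/= sum_word_prob_rcons -mulr_sumr.
by rewrite ler_piMr ?word_prob_ge0// sum_cond_prob_le1.
Qed.

(** The entropy drop is, up to the factor [ln 2], the relative entropy of [p] with respect to [q]:
    the common factor [P(u)] cancels in the logarithms. *)
Let entropy_diffE : (entropy P m - entropy P (j + m)) * ln 2 =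
  \sum_ua p ua * ln (p ua) - \sum_ua p ua * ln (q ua).
Proof.
rewrite mulrBl (entropyE P (j + m)) (entropy_suffixE P j)// opprK addrC !pair_bigA/=.
rewrite -!sumrB; apply: eq_bigr => -[u a] _.
have [p0|p0] := eqVneq (p (u, a)) 0.
  by rewrite p0; move: p0; rewrite /p/= => ->; rewrite !mul0r.
have : q (u, a) != 0 by apply: contra p0 => /eqP/q_eq0 ->.
rewrite mulf_eq0 negb_or/= => /andP[u0 c0].
have d0 : cond_prob P u a != 0.
  by apply: contra p0 => /eqP d0; rewrite /p/= word_prob_rcons d0 mulr0.
have pos (x : R) : 0 <= x -> x != 0 -> x \is Num.pos.
  by move=> ? ?; rewrite posrE lt0r; apply/andP.
rewrite /p /q/= word_prob_rcons.
rewrite (@lnM _ (word_prob P u) (cond_prob P u a)).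
- rewrite (@lnM _ (word_prob P u) (cond_prob P (drop j u) a)); first by ring.
  + by apply: pos => //; exact: word_prob_ge0.
  + by apply: pos => //; exact: cond_prob_ge0.
- by apply: pos => //; exact: word_prob_ge0.
- by apply: pos => //; exact: cond_prob_ge0.
Qed.

Lemma entropy_le : entropy P (j + m) <= entropy P m.
Proof.
rewrite -subr_ge0 -(pmulr_lge0 _ (@ln2_gt0 R)) entropy_diffE subr_ge0.
exact: gibbs.
Qed.

Lemma entropy_lt (u : (j + m).-tuple A) a : 0 < word_prob P u ->
  cond_prob P u a != cond_prob P (drop j u) a ->
  entropy P (j + m) < entropy P m.
Proof.
move=> u0 neq.
rewrite -subr_gt0 -(pmulr_lgt0 _ (@ln2_gt0 R)) entropy_diffE subr_gt0.
apply: gibbs_lt => //; exists (u, a); rewrite /p /q/= word_prob_rcons.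
by rewrite (inj_eq (mulfI (lt0r_neq0 u0))).
Qed.
End suffix.

Lemma entropy_nonincreasing P : stationary P ->
  {homo entropy P : n k / (n <= k)%N >-> k <= n}.
Proof. by move=> sP n k nk; rewrite -(subnK nk); exact: entropy_le. Qed.

(** The entropies are nonincreasing and bounded below by 0, so [limn] is a true limit and lies below
    every term. *)
Lemma entropy_rate_le P k : stationary P -> entropy_rate P <= entropy P k.
Proof.
move=> sP; apply: nonincreasing_cvgn_ge; first exact: entropy_nonincreasing.
apply: nonincreasing_is_cvgn; first exact: entropy_nonincreasing.
by exists 0 => _ [n _ <-]; exact: entropy_ge0.
Qed.

(** If every past of positive probability had the transition probabilities of its last [m] letters,
    [P] would be Markov of order [m]. So some past of length [j + m] violates this, and the entropy
    of order [j + m] is already strictly smaller. *)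
Lemma entropy_rate_lt P (m : nat) : M_infty P -> ~ markov_sources m P ->
  entropy_rate P < entropy P m.
Proof.
move=> MP nmP; have [sP _] := MP.
suff [j [u [a [u0 neq]]]] : exists j (u : (j + m).-tuple A) a,
    0 < word_prob P u /\ cond_prob P u a != cond_prob P (drop j u) a.
  by apply: le_lt_trans (entropy_rate_le P (j + m) sP) (entropy_lt P j m sP u a u0 neq).
apply: contrapT => H; apply: nmP; split=> // t u u' a mt.
have [j tE] : exists j, t = (j + m)%N by exists (t - m)%N; rewrite subnK.
subst t; rewrite addnK => u0 u'0 E.
have suffixE (w : (j + m).-tuple A) : 0 < word_prob P w ->
    cond_prob P w a = cond_prob P (drop j w) a.
  move=> w0; apply/eqP/negP => /negP neq; apply: H.
  by exists j, w, a.
by rewrite (suffixE u u0) (suffixE u' u'0) E.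
Qed.
End conditional_entropy.

(** * The Type II error *)

(** [P(E n)] is at most the probability of the union of the [E k] with [k >= n], which decreases to
    that of the limit superior, a null set. *)
Lemma cvg_measure_ae_eventually_not (d : measure_display)
    (T : measurableType d) (R : realType) (P : probability T R)
    (E : nat -> set T) :
  (forall n, measurable (E n)) ->
  {ae P, forall x, \forall n \near \oo, ~ E n x} ->
  P (E n) @[n --> \oo] --> 0%E.
Proof.
move=> mE aeE.
have PF : (P (\bigcup_(k in [set k | (n <= k)%N]) E k)) @[n --> \oo] --> 0%E.
  have <- : P (lim_sup_set E) = 0%E.
    apply: measure_negligible.
      by apply: bigcapT_measurable => n; exact: bigcup_measurable.
    apply: negligibleS aeE => x Ex [N _ HN].
    by have [k Nk Ek] := Ex N I; exact: HN Nk Ek.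
  apply: lim_sup_set_cvg => //; rewrite (le_lt_trans _ (ltry 1))//.
  by apply: probability_le1; exact: bigcup_measurable.
apply: (squeeze_cvge _ (cvg_cst 0%E) PF); apply: nearW => n.
rewrite measure_ge0/= le_measure ?inE//; first exact: bigcup_measurable.
by move=> x Ex; exists n => /=.
Qed.

Lemma accept_prob_cvg0 (R : realType) (A : alphabetType) (m : nat) (alpha : R)
    (phi : block_map A) (P : source R A) :
  universal R phi -> M_infty P -> ~ markov_sources m P ->
  accept_prob m alpha phi P t @[t --> \oo] --> 0%E.
Proof.
move=> uphi MP nmP.
apply: (cvg_measure_ae_eventually_not _ _ _ P
  (fun t => [set x | accepts m alpha phi (prefix_of t x)])) => [t|].
  exact: (measurable_prefix_event t (fun u => accepts m alpha phi u)).
have [aephi _] := uphi P MP.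
have gap := entropy_rate_lt P m MP nmP.
have FF : Filter (almost_everywhere P) := ae_filter_ringOfSetsType P.
apply: (@filterS2 _ _ FF _ _ _ _ aephi (ae_cvg_empirical_entropy P m MP)).
move=> x cphi cent.
have inv0 : (n%:R^-1 : R) @[n --> \oo] --> 0.
  by rewrite -cvg_shiftS; exact: cvg_harmonic.
(* This is the test statistic minus its threshold, divided by [n]; its limit is the gap between the
   entropy of order [m] and the entropy rate. *)
have lim : (1 - m%:R * n%:R^-1) * empirical_entropy m (prefix_of n x) -
    (code_length phi n x)%:R / n%:R - log2 (1 / alpha) * n%:R^-1
    @[n --> \oo] --> (1 - m%:R * 0) * entropy P m - entropy_rate P
      - log2 (1 / alpha) * 0.
  apply: cvgB; last by apply: cvgM => //; exact: cvg_cst.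
  apply: cvgB => //; apply: cvgM => //.
  by apply: cvgB; [exact: cvg_cst|apply: cvgM => //; exact: cvg_cst].
rewrite !mulr0 !subr0 [1 * entropy _ _]mul1r in lim.
rewrite -subr_gt0 in gap.
have [N _ HN] := cvgr_gt _ lim _ gap.
(* Taking [n > m] makes the truncated [n - m] a true difference and [n] nonzero. *)
exists (maxn N m.+1) => // n /=; rewrite geq_max => /andP[Nn mn].
have n0 : 0 < n%:R :> R by rewrite ltr0n (leq_trans _ mn).
apply/negP; rewrite /accepts -ltNge; have := HN n Nn => /=.
rewrite natrB ?(ltnW mn)// -(pmulr_lgt0 _ n0) -/(code_length phi n x).
rewrite !mulrBl mul1r !divfK ?gt_eqF//.
set h := empirical_entropy _ _; set L := log2 _.
have -> : m%:R / n%:R * h * n%:R = m%:R * h by rewrite mulrAC divfK ?gt_eqF.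
by lra.
Qed.

Theorem theorem7 (R : realType) (A : alphabetType) (m : nat) (alpha : R)
    (phi : block_map A)
    (alpha_in : 0 < alpha < 1)
    (phi_code : is_code phi) :
  (forall P : source R A, markov_sources m P ->
     forall t : nat, (m < t)%N ->
       (reject_prob m alpha phi P t <= alpha%:E)%E) /\
  (universal R phi ->
     forall P : source R A, (M_infty `\` markov_sources m) P ->
       accept_prob m alpha phi P t @[t --> \oo] --> (0 : \bar R)%E).
Proof.
have /andP[alpha0 _] := alpha_in; split=> [P mP t mt|uphi P [MP nmP]].
  exact: reject_prob_le.
exact: accept_prob_cvg0.
Qed.
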